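(* For any (finite-dimensional) quantity space $Q$ over $\mathcal{R}$, the quotient monoid $Q/{\sim}$ of dimensions in $Q$ is a free abelian group of finite rank.
   Context: $\mathcal{R}$ denotes one of the scalar systems $\mathbb{R}$, $\mathbb{R}_{\geq 0}$, $\mathbb{R}_{>0}$. A scalable monoid over $\mathcal{R}$ is a commutative monoid $Q$ (written multiplicatively, unit $1_Q$) with a map $\mathcal{R}\times Q\to Q$, $(\alpha,q)\mapsto\alpha q$, such that for all $\alpha,\beta\in\mathcal{R}$ and $q,q'\in Q$: $1q=q$, $\alpha(\beta q)=(\alpha\beta)q$, $\alpha(qq')=(\alpha q)q'$. An element $q$ is invertible if it has an inverse $q^{-1}\in Q$ with $qq^{-1}=q^{-1}q=1_Q$; integer powers of invertible elements are defined as usual, with $q^0=1_Q$. A (finite) basis for $Q$ is a set $B=\{b_1,\dots,b_n\}$ of invertible elements of $Q$ such that every $q\in Q$ has a unique (up to order of factors) expansion $q=\mu\prod_{i=1}^n b_i^{k_i}$ with $\mu\in\mathcal{R}$ and $k_1,\dots,k_n\in\mathbb{Z}$. A (finite-dimensional) quantity space over $\mathcal{R}$ is a scalable monoid over $\mathcal{R}$ that has a finite basis. On $Q$, $q\sim q'$ (equidimensionality) means that $\alpha q=\beta q'$ for some $\alpha,\beta\in\mathcal{R}$; $\sim$ is a congruence relation, its equivalence classes $[q]$ are called dimensions, and $Q/{\sim}$ carries the product $[q][q']=[qq']$. *)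

(* Defs.v *)
From HB Require Import structures.
From mathcomp Require Import all_boot all_order all_algebra.
From mathcomp Require Import boolp classical_sets reals.

Set Implicit Arguments.
Unset Strict Implicit.
Unset Printing Implicit Defensive.

Import Order.TTheory GRing.Theory Num.Theory.

Local Open Scope ring_scope.
Local Open Scope quotient_scope.

Inductive scalar_system := AllReals | NonnegReals | PosReals.

Definition scalar_pred (R : realType) (s : scalar_system) : {pred R} :=
  match s with
  | AllReals => predT
  | NonnegReals => [pred x | 0 <= x]
  | PosReals => [pred x | 0 < x]
  end.

Arguments scalar_pred : clear implicits.

Definition scalars (R : realType) (s : scalar_system) :=
  {x : R | x \in scalar_pred R s}.

Section Scalars.
Variables (R : realType) (s : scalar_system).

Lemma scalar1_subproof : (1 : R) \in scalar_pred R s.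
Proof. by case: s; rewrite inE ?ler01 ?ltr01. Qed.

Lemma scalarM_subproof (a b : scalars R s) :
  val a * val b \in scalar_pred R s.
Proof.
case: a b => a + [b]; rewrite /=.
by case: s => //=; rewrite !inE; [exact: mulr_ge0 | exact: mulr_gt0].
Qed.

Definition scalar1 : scalars R s := exist _ 1 scalar1_subproof.
Definition scalarM (a b : scalars R s) : scalars R s :=
  exist _ (val a * val b) (scalarM_subproof a b).

End Scalars.

Arguments scalar1 {R s}.

HB.mixin Record Monoid_isCommutative Q of Monoid Q := {
  mulmC : forall x y : Q, (x * y)%g = (y * x)%g
}.

#[short(type="comMonoidType")]
HB.structure Definition ComMonoid := {Q of Monoid_isCommutative Q & Monoid Q}.

HB.mixin Record ComMonoid_isScalable (R : realType) (s : scalar_system) Q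
    of ComMonoid Q := {
  scaleq : scalars R s -> Q -> Q;
  scale1q : forall q, scaleq scalar1 q = q;
  scaleqA : forall a b q, scaleq a (scaleq b q) = scaleq (scalarM a b) q;
  scaleqMl : forall a (q q' : Q), scaleq a (q * q')%g = (scaleq a q * q')%g
}.

#[short(type="scalableMonoidType")]
HB.structure Definition ScalableMonoid (R : realType) (s : scalar_system) :=
  {Q of ComMonoid_isScalable R s Q & ComMonoid Q}.

Section IntegerPowers.
Variable M : monoidType.
Implicit Type x y : M.
Local Open Scope group_scope.

Definition is_inverse x y := x * y = 1 /\ y * x = 1.

Definition invertible x := exists y, is_inverse x y.

(* The inverse of [x] if [x] is invertible, and [1] otherwise. *)
Definition minv x : M := xget 1 [set y | is_inverse x y].

Lemma minvP x : invertible x -> is_inverse x (minv x).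
Proof. by case=> y xy; rewrite /minv; case: xgetP => [//|/(_ y)]. Qed.

(* Only meaningful for negative [k] if [x] is invertible;
   [Negz n] is the integer [- n.+1]. *)
Definition zexp x (k : int) : M :=
  match k with
  | Posz n => x ^+ n
  | Negz n => minv x ^+ n.+1
  end.

Definition free_abelian_group_of_finite_rank :=
  [/\ forall x y, x * y = y * x,
      forall x, invertible x
    & exists (n : nat) (e : 'I_n -> M),
        forall x, exists! k : {ffun 'I_n -> int},
          x = \prod_(i < n) zexp (e i) (k i)].

End IntegerPowers.

Arguments free_abelian_group_of_finite_rank : clear implicits.

Section QuantitySpaces.
Variables (R : realType) (s : scalar_system) (Q : scalableMonoidType R s).

(* The set [{b_1, .., b_n}] is given by its enumeration [b], which uniqueness
   of the expansions forces to be injective. *)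
Definition is_basis (n : nat) (b : 'I_n -> Q) :=
  (forall i, invertible (b i)) /\
  forall q : Q, exists! mk : scalars R s * {ffun 'I_n -> int},
    q = scaleq mk.1 (\prod_(i < n) zexp (b i) (mk.2 i))%g.

Definition is_quantity_space := exists (n : nat) (b : 'I_n -> Q), is_basis b.

Definition equidimensional (q q' : Q) : Prop :=
  exists a b : scalars R s, scaleq a q = scaleq b q'.

Definition equidim : rel Q := fun q q' => `[< equidimensional q q' >].

Lemma equidim_refl : reflexive equidim.
Proof. by move=> q; apply/asboolP; exists scalar1, scalar1. Qed.

Lemma equidim_sym : symmetric equidim.
Proof. by move=> p q; apply/asboolP/asboolP => -[a [b e]]; exists b, a. Qed.

Lemma scalarMC (a b : scalars R s) : scalarM a b = scalarM b a.
Proof. by apply: val_inj; rewrite /= mulrC. Qed.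

Lemma scaleqC (a b : scalars R s) (q : Q) :
  scaleq a (scaleq b q) = scaleq b (scaleq a q).
Proof. by rewrite !scaleqA scalarMC. Qed.

Lemma equidim_trans : transitive equidim.
Proof.
move=> q p r /asboolP[a [b pq]] /asboolP[c [d qr]]; apply/asboolP.
by exists (scalarM c a), (scalarM b d); rewrite -!scaleqA pq -qr scaleqC.
Qed.

Lemma scaleqMr (a : scalars R s) (p q : Q) :
  scaleq a (p * q)%g = (p * scaleq a q)%g.
Proof. by rewrite mulmC scaleqMl mulmC. Qed.

Lemma equidim_congr (p p' q q' : Q) :
  equidim p p' -> equidim q q' -> equidim (p * q)%g (p' * q')%g.
Proof.
move=> /asboolP[a [b pp']] /asboolP[c [d qq']]; apply/asboolP.
exists (scalarM a c), (scalarM b d).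
by rewrite -!scaleqA (scaleqMr c p) (scaleqMr d p') !scaleqMl pp' qq'.
Qed.

Canonical equidim_equiv :=
  EquivRel equidim equidim_refl equidim_sym equidim_trans.

Definition dimension := {eq_quot equidim_equiv}.

HB.instance Definition _ := Choice.on dimension.
HB.instance Definition _ := Quotient.on dimension.
HB.instance Definition _ := EqQuotient.on dimension.

(* The dimension [[q]] of [q]. *)
Definition dim_of (q : Q) : dimension := \pi q.

Lemma dimP (x : dimension) : exists q, x = dim_of q.
Proof. by exists (repr x); rewrite /dim_of reprK. Qed.

Lemma dim_eqP (p q : Q) : dim_of p = dim_of q <-> equidimensional p q.
Proof.
by split=> [/(@eqmodP _ equidim_equiv)/asboolP|/asboolP/(@eqmodP _ equidim_equiv)].
Qed.

Definition dimM (x y : dimension) : dimension := dim_of (repr x * repr y)%g.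

Lemma dim_dimM (p q : Q) : dimM (dim_of p) (dim_of q) = dim_of (p * q)%g.
Proof.
have dim_repr q' : equidim (repr (dim_of q')) q'.
  by apply/asboolP/dim_eqP; rewrite /dim_of reprK.
by apply/dim_eqP/asboolP/equidim_congr.
Qed.

Lemma dimMA : associative dimM.
Proof.
move=> x y z; have [p ->] := dimP x; have [q ->] := dimP y.
have [r ->] := dimP z.
by rewrite (dim_dimM q r) (dim_dimM p q) !dim_dimM mulgA.
Qed.

Lemma dim1M : left_id (dim_of 1%g) dimM.
Proof. by move=> x; have [q ->] := dimP x; rewrite dim_dimM mul1g. Qed.

Lemma dimM1 : right_id (dim_of 1%g) dimM.
Proof. by move=> x; have [q ->] := dimP x; rewrite dim_dimM mulg1. Qed.

Lemma dimMC : commutative dimM.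
Proof.
move=> x y; have [p ->] := dimP x; have [q ->] := dimP y.
by rewrite !dim_dimM mulmC.
Qed.

HB.instance Definition _ := isMonoid.Build dimension dimMA dim1M dimM1.
HB.instance Definition _ := Monoid_isCommutative.Build dimension dimMC.

End QuantitySpaces.

Arguments is_quantity_space {R s} Q.
Arguments dimension {R s} Q.

(* Main.v *)
Require Import Defs.
From mathcomp Require Import all_boot all_order all_algebra.
From mathcomp Require Import boolp classical_sets reals.

(** If [b] is a basis of [Q], the classes [[b_i]] form a basis of the quotient:
they generate since [q = mu * b^k] is equidimensional to [b^k], and
[alpha * b^k = beta * b^l] forces [k = l] by uniqueness of expansions.  The
latter needs no cancellation of scalars, so zero scalars cause no collapse. *)

Set Implicit Arguments.
Unset Strict Implicit.
Unset Printing Implicit Defensive.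

Local Open Scope group_scope.

Section Monoids.
Variable M : monoidType.
Implicit Types x y : M.

Lemma is_inverse_uniq x y z : is_inverse x y -> is_inverse x z -> y = z.
Proof. by move=> [_ yx] [xz _]; rewrite -[y]mulg1 -xz mulgA yx mul1g. Qed.

(** Since [minv] is only a choice among inverses, uniqueness is what identifies it with a given
    inverse, such as the image of an inverse under a morphism. *)
Lemma is_inverse_minv x y : is_inverse x y -> minv x = y.
Proof. by move=> xy; apply: (is_inverse_uniq _ xy); apply: minvP; exists y. Qed.

Lemma invertible1 : invertible (1 : M).
Proof. by exists 1; split; rewrite mulg1. Qed.

Lemma invertibleM x y : invertible x -> invertible y -> invertible (x * y).
Proof.
move=> [x' [xx' x'x]] [y' [yy' y'y]]; exists (y' * x'); split.
  by rewrite mulgA -(mulgA x) yy' mulg1.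
by rewrite mulgA -(mulgA y') x'x mulg1.
Qed.

Lemma invertibleX x n : invertible x -> invertible (x ^+ n).
Proof.
move=> ux; elim: n => [|n IHn]; first by rewrite expg0; exact: invertible1.
by rewrite expgS; exact: invertibleM.
Qed.

Lemma invertible_minv x : invertible x -> invertible (minv x).
Proof. by move=> /minvP[xy yx]; exists x. Qed.

Lemma invertible_zexp x k : invertible x -> invertible (zexp x k).
Proof.
by case: k => n ux; apply: invertibleX => //; exact: invertible_minv.
Qed.

End Monoids.

Section MonoidMorphisms.
Variables (M N : monoidType) (f : M -> N).
Hypotheses (f1 : f 1 = 1) (fM : {morph f : x y / x * y}).

Lemma morph_is_inverse x y : is_inverse x y -> is_inverse (f x) (f y).
Proof. by move=> [xy yx]; split; rewrite -fM ?xy ?yx f1. Qed.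

Lemma morph_invertible x : invertible x -> invertible (f x).
Proof. by move=> [y /morph_is_inverse]; exists (f y). Qed.

Lemma morph_expg x n : f (x ^+ n) = f x ^+ n.
Proof. by elim: n => [|n IHn]; rewrite ?expg0 // !expgS fM IHn. Qed.

(** For negative [k] invertibility matters: at a non-invertible [x], [minv x] defaults to [1],
    although [f x] may have a nontrivial inverse. *)
Lemma morph_zexp x k : invertible x -> f (zexp x k) = zexp (f x) k.
Proof.
(* The image of [minv x] is an inverse of [f x], hence equals [minv (f x)]. *)
move=> /minvP/morph_is_inverse/is_inverse_minv fxV.
by case: k => n; rewrite /= morph_expg ?fxV.
Qed.

End MonoidMorphisms.

Section Dimensions.
Variables (R : realType) (s : scalar_system) (Q : scalableMonoidType R s).

Lemma dim_of1 : dim_of (1 : Q) = 1.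
Proof. by []. Qed.

Lemma dim_ofM : {morph @dim_of R s Q : p q / p * q}.
Proof. by move=> p q; rewrite -dim_dimM. Qed.

Lemma dim_of_scaleq (a : scalars R s) (q : Q) : dim_of (scaleq a q) = dim_of q.
Proof. by apply/dim_eqP; exists scalar1, a; rewrite scale1q. Qed.

Variables (n : nat) (b : 'I_n -> Q).
Hypothesis b_basis : is_basis b.

Let monomial (k : 'I_n -> int) : Q := \prod_(i < n) zexp (b i) (k i).

Lemma dim_of_monomial (k : 'I_n -> int) :
  dim_of (monomial k) = \prod_(i < n) zexp (dim_of (b i)) (k i).
Proof.
rewrite (big_morph _ dim_ofM dim_of1); apply: eq_bigr => i _.
by apply: (morph_zexp dim_of1 dim_ofM); exact: b_basis.1.
Qed.

Lemma dim_of_monomial_inj (k l : {ffun 'I_n -> int}) :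
  dim_of (monomial k) = dim_of (monomial l) -> k = l.
Proof.
move=> /dim_eqP[a [c e]].
(* The element [scaleq a (monomial k)] has both [(a, k)] and [(c, l)] as expansions, the second by
   [e]. *)
have [mk [_ mk_uniq]] := b_basis.2 (scaleq a (monomial k)).
by have := mk_uniq (a, k) erefl; rewrite (mk_uniq (c, l) e) => -[].
Qed.

Lemma dimension_monomial (x : dimension Q) :
  exists k : {ffun 'I_n -> int}, x = dim_of (monomial k).
Proof.
have [q ->] := dimP x; have [[mu k] [-> _]] := b_basis.2 q.
by exists k; rewrite dim_of_scaleq.
Qed.

(** An arbitrary representative may fail to be invertible, for instance with zero coefficient, so
    the monomial representative is used: it is a product of powers of invertible basis elements. *)
Lemma dimension_invertible (x : dimension Q) : invertible x.
Proof.
have [k ->] := dimension_monomial x.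
apply: (morph_invertible dim_of1 dim_ofM).
apply: big_ind => [|p q|i _]; [exact: invertible1 | exact: invertibleM |].
by apply: invertible_zexp; exact: b_basis.1.
Qed.

End Dimensions.

Theorem corollary1 (R : realType) (s : scalar_system)
    (Q : scalableMonoidType R s) (hQ : is_quantity_space Q) :
  free_abelian_group_of_finite_rank (dimension Q).
Proof.
have [n [b b_basis]] := hQ; split=> [x y|x|].
- exact: mulmC.
- exact: dimension_invertible b_basis x.
exists n, (fun i => dim_of (b i)) => x.
have [k ->] := dimension_monomial b_basis x; exists k.
(* Folding the product of classes back into the class of a monomial settles existence and reduces
   uniqueness to injectivity on exponents. *)
split=> [|l]; rewrite -?dim_of_monomial //.
exact: dim_of_monomial_inj.
Qed.
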